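(* Let $p_+,p_-$ be probability densities on $\mathcal{X}\subseteq\mathbb{R}^d$ with $p_->0$ on $\mathcal{X}$. Let $F_+^*$ and $F_-^*$ be the CDFs of the optimal score $t^*(x)=\arctan\frac{p_+(x)}{p_-(x)}$ under $p_+$ and $p_-$ respectively, and let $$w(\tau):=\sin\!\big(\tau+\tfrac{\pi}{4}\big)\cdot\big|F_+^*(\tau)-F_-^*(\tau)\big| .$$ Then $\mathrm{AUC}^*=\frac{\sqrt2}{2}A+\frac12$, where $$A:=\sup_{v}\ \mathbb{E}_{p_+}\!\left[w\!\left(\arctan\frac{p_+(x)}{p_-(x)}\right)\sin v(x)\right]+\mathbb{E}_{p_-}\!\left[w\!\left(\arctan\frac{p_+(x)}{p_-(x)}\right)\cos v(x)\right],$$ the supremum being over all measurable $v:\mathcal{X}\to[0,\pi/2]$. The supremum is attained at $v^*(x)=\arctan\frac{p_+(x)}{p_-(x)}$.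
   Context: For a measurable score function $t:\mathcal{X}\to\mathbb{R}$, $F_\pm$ denote the CDFs of $t(x^\pm)$ with $x^\pm$ having density $p_\pm$, and $\tilde F_\pm=1-F_\pm$. The ROC curve $\mathrm{ROC}(t)$ is the graph of $s\mapsto\tilde F_+(\tilde F_-^{-1}(s))$, $s\in[0,1]$, and $$\mathrm{AUC}(t)=\int_0^1\tilde F_+(\tilde F_-^{-1}(s))\,\mathrm{d}s=\mathbb{E}_{x^-\sim p_-}\mathbb{E}_{x^+\sim p_+}\big[\mathbf{1}(t(x^+)\ge t(x^-))\big].$$ An optimal score is $\gamma\!\left(\frac{p_+(x)}{p_-(x)}\right)$ with $\gamma$ strictly increasing; all optimal scores have the same ROC curve $\mathrm{ROC}^*$, and $\mathrm{AUC}^*$ is its area under the curve (the maximal AUC). Standing assumptions: $F_+^*$ and $F_-^*$ are strictly increasing on the interval of score values and have densities $f_+^*,f_-^*$ (with $f_-^*>0$ on that interval). *)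

(* Defs.v *)
From HB Require Import structures.
From mathcomp Require Import all_boot all_order all_algebra.
From mathcomp Require Import all_classical all_reals all_analysis.
From mathcomp Require Import measurable_realfun.

Set Implicit Arguments.
Unset Strict Implicit.
Unset Printing Implicit Defensive.

Import Order.TTheory GRing.Theory Num.Theory.
Import numFieldNormedType.Exports.

Local Open Scope classical_set_scope.
Local Open Scope ring_scope.

Section lebesgue_cons.
Context (R : realType) (n : nat).
Variable m : {sigma_finite_measure set (n.-tuple R) -> \bar R}.
Local Open Scope ereal_scope.

Let cons2 (z : R * n.-tuple R) : n.+1.-tuple R := [tuple of z.1 :: z.2].
Let uncons (t : n.+1.-tuple R) : R * n.-tuple R :=
  (tnth t ord0, [tuple of behead t]).

Let measurable_cons2 : measurable_fun [set: R * n.-tuple R] cons2.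
Proof. exact: measurable_cons. Qed.

Let measurable_uncons : measurable_fun [set: n.+1.-tuple R] uncons.
Proof.
by apply: measurable_fun_pair;
  [exact: measurable_tnth|exact: measurable_behead].
Qed.

Let cons2K : cancel cons2 uncons.
Proof. by move=> [x t]; congr pair; exact: val_inj. Qed.

(* Lebesgue measure on R^(n+1) = R * R^n, when m is Lebesgue measure on R^n. *)
Definition lebesgue_cons : set (n.+1.-tuple R) -> \bar R :=
  pushforward (@lebesgue_measure R \x m) cons2.

Let lebesgue_cons0 : lebesgue_cons set0 = 0.
Proof. by rewrite /lebesgue_cons /pushforward preimage_set0 measure0. Qed.

Let lebesgue_cons_ge0 A : 0 <= lebesgue_cons A.
Proof. exact: measure_ge0. Qed.

Let lebesgue_cons_sigma_additive : semi_sigma_additive lebesgue_cons.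
Proof.
move=> F mF tF mUF; rewrite /lebesgue_cons /pushforward preimage_bigcup.
apply: measure_semi_sigma_additive.
- by move=> k; rewrite -[X in measurable X]setTI; exact: measurable_cons2.
- apply/trivIsetP => /= i j _ _ ij; rewrite -preimage_setI.
  by move/trivIsetP : tF => /(_ _ _ _ _ ij) ->//; rewrite preimage_set0.
- rewrite -preimage_bigcup -[X in measurable X]setTI.
  exact: measurable_cons2.
Qed.

HB.instance Definition _ := isMeasure.Build _ _ _ lebesgue_cons
  lebesgue_cons0 lebesgue_cons_ge0 lebesgue_cons_sigma_additive.

Let lebesgue_cons_sigma_finite : sigma_finite setT lebesgue_cons.
Proof.
have /sigma_finiteP[F [FT Fnd mF]] := sigma_finiteT (@lebesgue_measure R).
have /sigma_finiteP[G [GT Gnd mG]] := sigma_finiteT m.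
exists (fun k => uncons @^-1` (F k `*` G k)).
  rewrite -preimage_bigcup (_ : \bigcup_k _ = setT) ?preimage_setT//.
  apply/seteqP; split => // -[x y] _.
  have [i _ Fx] : (\bigcup_k F k) x by rewrite -FT.
  have [j _ Gy] : (\bigcup_k G k) y by rewrite -GT.
  exists (maxn i j) => //; split => /=.
  - by move: x Fx; exact/subsetPset/Fnd/leq_maxl.
  - by move: y Gy; exact/subsetPset/Gnd/leq_maxr.
move=> k; have [? ?] := mF k; have [? ?] := mG k; split.
  rewrite -[X in measurable X]setTI; apply: measurable_uncons => //.
  exact: measurableX.
rewrite /lebesgue_cons /pushforward -comp_preimage.
rewrite (_ : uncons \o cons2 = id); last by apply/funext => z; exact: cons2K.
by rewrite preimage_id product_measure1E// lte_mul_pinfty// ge0_fin_numE.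
Qed.

HB.instance Definition _ := Measure_isSigmaFinite.Build _ _ _ lebesgue_cons
  lebesgue_cons_sigma_finite.

End lebesgue_cons.

(* Lebesgue measure on R^n (lebesgue_tuple_box gives its value on boxes). *)
Fixpoint lebesgue_tuple (R : realType) (n : nat) :
    {sigma_finite_measure set (n.-tuple R) -> \bar R} :=
  match n with
  | 0 => \d_ [tuple]
  | k.+1 => lebesgue_cons (lebesgue_tuple R k)
  end.

Lemma lebesgue_tuple_box (R : realType) (n : nat) (B : 'I_n -> set R) :
  (forall i, measurable (B i)) ->
  lebesgue_tuple R n [set x | forall i, B i (tnth x i)] =
  (\prod_(i < n) lebesgue_measure (B i))%E.
Proof.
elim: n B => [|n IH] B mB.
  by rewrite big_ord0 /= diracE mem_set// => -[].
rewrite big_ord_recl -IH//=.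
have mbox : measurable [set x : n.-tuple R | forall i, B (lift ord0 i) (tnth x i)].
  rewrite (_ : mkset _ = \bigcap_i ((@tnth n R)^~ i @^-1` (B (lift ord0 i)))).
    apply: fin_bigcap_measurable => // i _.
    by rewrite -[X in measurable X]setTI; exact: measurable_tnth.
  by apply/seteqP; split => x /= H i => [_|]; [exact: H|exact: H i I].
rewrite -product_measure1E//=; last exact: mB.
rewrite /lebesgue_cons /pushforward; congr (product_measure1 _ _ _).
apply/seteqP; split => -[a x] /=.
  by move=> H; split=> [|i]; [exact: (H ord0)|have := H (lift ord0 i); rewrite tnthS].
by move=> [Ha Hx] i; case: (unliftP ord0 i) => [j ->|->]//; rewrite tnthS; exact: Hx.
Qed.

(* A density on X is extended by 0 to the whole of R^n, so that the law it
   defines is carried by X. *)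
Record density (R : realType) (n : nat) (X : set (n.-tuple R)) := Density {
  density_fun :> n.-tuple R -> R ;
  density_measurable : measurable_fun [set: n.-tuple R] density_fun ;
  density_ge0 : forall x, 0 <= density_fun x ;
  density_eq0 : forall x, ~ X x -> density_fun x = 0 ;
  density_int1 : (\int[lebesgue_tuple R n]_x (density_fun x)%:E = 1)%E }.

Section density_prob.
Context (R : realType) (n : nat) (X : set (n.-tuple R)) (p : density X).
Local Open Scope ereal_scope.

Definition density_prob (A : set (n.-tuple R)) : \bar R :=
  \int[lebesgue_tuple R n]_(x in A) (p x)%:E.

Let density_prob0 : density_prob set0 = 0.
Proof. exact: integral_set0. Qed.

Let density_prob_ge0 A : 0 <= density_prob A.
Proof. by apply: integral_ge0 => x _; rewrite lee_fin density_ge0. Qed.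

Let density_prob_sigma_additive : semi_sigma_additive density_prob.
Proof.
move=> F mF tF mUF; rewrite /density_prob ge0_integral_bigcup//.
- apply: is_cvg_ereal_nneg_natsum_cond => k _ _.
  exact: density_prob_ge0.
- apply: measurable_funTS; apply/measurable_EFinP.
  exact: density_measurable.
- by move=> x _; rewrite lee_fin density_ge0.
Qed.

HB.instance Definition _ := isMeasure.Build _ _ _ density_prob
  density_prob0 density_prob_ge0 density_prob_sigma_additive.

Let density_prob_setT : density_prob setT = 1.
Proof. exact: density_int1. Qed.

HB.instance Definition _ := Measure_isProbability.Build _ _ _ density_prob
  density_prob_setT.

HB.instance Definition _ := isMeasurableFun.Build _ _ _ _ (density_fun p)
  (density_measurable p).

End density_prob.

Section roc.
Context d (T : measurableType d) (R : realType).
Variables (Pp Pm : probability T R) (t : {mfun T >-> R}).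
Local Open Scope ereal_scope.

(* 1 - F, extended to \bar R by its limits. *)
Definition eccdf (P : probability T R) (y : \bar R) : \bar R :=
  match y with
  | r%:E => ccdf (t : {RV P >-> R}) r
  | +oo => 0
  | -oo => 1
  end.

(* Generalized inverse of the non-increasing function 1 - F. *)
Definition eccdf_inv (P : probability T R) (s : R) : \bar R :=
  ereal_inf [set y | eccdf P y <= s%:E].

Definition ROC (s : R) : \bar R := eccdf Pp (eccdf_inv Pm s).

Definition AUC : \bar R := \int[lebesgue_measure]_(s in `[0%R, 1%R]) ROC s.

End roc.

Section optimal.
Context (R : realType) (n : nat) (X : set (n.-tuple R)) (pp pm : density X).

(* A score matters only on X; gamma is applied to a ratio, hence on [0, +oo[. *)
Definition optimal_score (t : n.-tuple R -> R) : Prop :=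
  exists2 gamma : R -> R,
    {in `[0, +oo[ &, {homo gamma : a b / a < b}} &
    forall x, X x -> t x = gamma (pp x / pm x).

Definition tstar (x : n.-tuple R) : R := atan (pp x / pm x).

Let measurable_tstar : measurable_fun [set: n.-tuple R] tstar.
Proof.
have -> : tstar = @atan R \o (fun x => pp x / pm x) by [].
apply: measurableT_comp.
  by apply: continuous_measurable_fun; exact: continuous_atan.
apply: measurable_funM; first exact: density_measurable.
have -> : (fun x => (pm x)^-1) = GRing.inv \o pm by [].
apply: measurableT_comp; last exact: density_measurable.
rewrite -(setvU [set 0 : R]); apply/measurable_funU.
- exact: measurableC.
- by [].
split; last exact: measurable_fun_set1.
apply: open_continuous_measurable_fun; first exact: closed_openC.
by move=> x /set_mem /= /eqP x0; exact: inv_continuous.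
Qed.

HB.instance Definition _ := isMeasurableFun.Build _ _ _ _ tstar
  measurable_tstar.

Definition Fstar (p : density X) (tau : R) : R :=
  fine (cdf (tstar : {RV density_prob p >-> R}) tau).

(* The smallest interval containing the values of t* on X. *)
Definition score_interval : set R :=
  [set tau | exists x y, [/\ X x, X y & tstar x <= tau <= tstar y]].

Definition is_density_of (F f : R -> R) : Prop :=
  [/\ measurable_fun [set: R] f, forall tau, 0 <= f tau &
      forall tau, ((F tau)%:E =
        \int[lebesgue_measure]_(u in `]-oo, tau]) (f u)%:E)%E].

Definition w (tau : R) : R :=
  sin (tau + pi / 4) * `|Fstar pp tau - Fstar pm tau|.

Definition objective (v : n.-tuple R -> R) : \bar R :=
  ('E_(density_prob pp)[(fun x => w (tstar x) * sin (v x))%R] +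
   'E_(density_prob pm)[(fun x => w (tstar x) * cos (v x))%R])%E.

(* Measurable functions from X to [0, pi/2], up to their values outside X, which
   is a null set for both distributions. *)
Definition admissible (v : n.-tuple R -> R) : Prop :=
  measurable_fun [set: n.-tuple R] v /\
  forall x, X x -> 0 <= v x <= pi / 2.

End optimal.

(* Main.v *)
(* The area under the ROC curve is the probability that a positive score beats a
   negative one, i.e. the integral of M [t y < t x] over x under P (P, M being the
   laws with densities p_+, p_-). It depends only on the order induced by t, so
   every optimal t may be replaced by tau = tstar.
   For fixed x, p_+ sin v + p_- cos v is the scalar product of (p_-, p_+) with the
   unit vector of angle v, which is largest at the angle tau of (p_-, p_+). There
   sin (tau + pi/4) turns it into (p_+ + p_-) sqrt 2 / 2, and since F_+ <= F_- the
   supremum is the integral of (F_- - F_+)(tau) sqrt 2 / 2 under P plus the same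
   under M. As tau has no atoms, Fubini gives
   int F_p(tau) dQ + int F_q(tau) dP = 1 for any two laws P, Q among the two,
   which evaluates the four integrals in terms of the AUC. *)
Require Import Defs.
From HB Require Import structures.
From mathcomp Require Import all_boot all_order all_algebra.
From mathcomp Require Import all_classical all_reals all_analysis.
From mathcomp Require Import measurable_realfun ring lra.

Import Order.TTheory GRing.Theory Num.Theory.
Import numFieldNormedType.Exports.

Local Open Scope classical_set_scope.
Local Open Scope ring_scope.

(** * Generalized inverse of the survival function, and the AUC as a pairwise probability *)

Section roc_area.
Context d (T : measurableType d) (R : realType).
Variables (M : probability T R) (t : {mfun T >-> R}).
Local Open Scope ereal_scope.

(** The conventions at the infinite points make one formula valid on the whole extended line, so
    later arguments need no case split. *)
Lemma eccdfE (y : \bar R) : eccdf t M y = M [set x | y < (t x)%:E].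
Proof.
case: y => [r| |] /=.
- rewrite /ccdf /distribution /pushforward; congr (M _).
  by apply/seteqP; split => x /=; rewrite in_itv/= andbT lte_fin.
- rewrite (_ : mkset _ = set0) ?measure0//.
  by apply/seteqP; split => x //=; rewrite ltNge leey.
- rewrite (_ : mkset _ = setT) ?probability_setT//.
  by apply/seteqP; split => x //= _; rewrite ltNyr.
Qed.

Lemma eccdf_inv_nonincreasing (s1 s2 : R) : (s1 <= s2)%R ->
  eccdf_inv t M s2 <= eccdf_inv t M s1.
Proof.
move=> s12; apply: ereal_inf_le_tmp => y /= ys1.
by rewrite (le_trans ys1)// lee_fin.
Qed.

Lemma measurable_eccdf_inv : measurable_fun [set: R] (eccdf_inv t M).
Proof.
have mE : (@measurable _ (\bar R)) = <<s @ErealGenInftyO.G R >>.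
  exact: ErealGenInftyO.measurableE.
(* By monotonicity the preimage of each generating ray is an interval. *)
apply: (measurability _ mE) => _ [_] [r] -> <-.
apply: measurableI => //; apply: is_interval_measurable => a b /=.
rewrite !in_itv/= => ar _ u /andP[au _].
by rewrite in_itv/= (le_lt_trans _ ar)// eccdf_inv_nonincreasing.
Qed.

Let m c := M [set x | (c <= t x)%R].

Lemma measurable_ge c : measurable [set x | (c <= t x)%R].
Proof.
rewrite (_ : mkset _ = t @^-1` `[c, +oo[).
  exact: measurable_funPTI.
by apply/seteqP; split => x /=; rewrite in_itv/= andbT.
Qed.

(* Because [M (t > y)] tends to [M (t >= c)] as [y] increases to [c]. *)
Lemma eccdf_inv_lt (c s : R) : m c < s%:E -> eccdf_inv t M s < c%:E.
Proof.
move=> ms.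
pose F n := [set x | (c - n.+1%:R^-1 < t x)%R].
have mF n : measurable (F n).
  rewrite (_ : F n = t @^-1` `]c - n.+1%:R^-1, +oo[)%R.
    exact: measurable_funPTI.
  by apply/seteqP; split => x /=; rewrite in_itv/= andbT.
have capF : \bigcap_n F n = [set x | (c <= t x)%R].
  apply/seteqP; split => x /=.
    move=> Fx; rewrite leNgt; apply/negP => tc.
    have := ltr_add_invr tc => -[k].
    rewrite -ltrBrDr => h; have := Fx k I; rewrite /F /= => /(lt_trans h).
    by rewrite ltxx.
  by move=> cx n _; rewrite /F/= (lt_le_trans _ cx)// ltrBlDr ltrDl invr_gt0.
have : M \o F @ \oo --> M (\bigcap_n F n).
  apply: nonincreasing_cvg_mu => //.
  - by rewrite (le_lt_trans (probability_le1 _ _))// ltry.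
  - by rewrite capF; exact: measurable_ge.
  - move=> i j ij; apply/subsetPset => x; rewrite /F /=; apply: le_lt_trans.
    by rewrite lerD2l lerN2 lef_pV2 ?posrE// ler_nat.
rewrite capF => MF.
have /MF[k _ /(_ _ (leqnn k)) /= ks] : nbhs (m c) [set y | y < s%:E].
  by apply: open_nbhs_nbhs; split => //; exact: open_ereal_lt_ereal.
apply: (@le_lt_trans _ _ (c - k.+1%:R^-1)%:E).
  apply: ereal_inf_lbound => /=; rewrite -[ccdf _ _]/(eccdf t M (_%:E)) eccdfE.
  by rewrite (_ : mkset _ = F k) ?ltW.
by rewrite lte_fin ltrBlDr ltrDl invr_gt0.
Qed.

(** Partial converse of [eccdf_inv_lt]: some level [y < c] has [M (t > y) <= s], and [t >= c]
    implies [t > y]. Only the single point [s = m c] stays undecided. *)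
Lemma eccdf_inv_lt_ge (c s : R) : eccdf_inv t M s < c%:E -> m c <= s%:E.
Proof.
move=> /ereal_inf_lt[y /= ys yc]; apply: le_trans ys; rewrite eccdfE.
apply: le_measure; rewrite ?inE; first exact: measurable_ge.
- rewrite -[X in measurable X]setTI; apply: measurable_lte => //.
  exact/measurable_EFinP.
- by move=> x /= cx; rewrite (lt_le_trans yc)// lee_fin.
Qed.

(** Inverse transform sampling: for uniform [s] the generalized inverse has the law of [t] under
    [M]. The set lies between []m c, 1]] and [[m c, 1]], both of length [1 - m c]. *)
Lemma lebesgue_eccdf_inv_lt (c : R) :
  lebesgue_measure [set s | (0 <= s <= 1)%R /\ eccdf_inv t M s < c%:E] =
  M [set x | (t x < c)%R].
Proof.
have mfin : m c \is a fin_num by apply: fin_num_measure; exact: measurable_ge.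
have [m0 m1] : (0 <= fine (m c))%R /\ (fine (m c) <= 1)%R.
  by rewrite fine_ge0//; split=> //; rewrite -lee_fin fineK// probability_le1//;
    exact: measurable_ge.
have -> : M [set x | (t x < c)%R] = (1 - fine (m c))%:E.
  rewrite EFinB fineK// -probability_setC; last exact: measurable_ge.
  by congr (M _); apply/seteqP; split => x /=; rewrite ltNge => /negP.
set S := [set s | _ /\ _].
have mS : measurable S.
  rewrite (_ : S = `[0%R, 1%R] `&` [set s | eccdf_inv t M s < c%:E]); last first.
    by apply/seteqP; split => x /=; rewrite in_itv/=.
  apply: measurable_lte => //; apply: measurable_funTS.
  exact: measurable_eccdf_inv.
apply/eqP; rewrite eq_le; apply/andP; split.
- rewrite (_ : (1 - _)%:E = lebesgue_measure `[fine (m c), 1%R]); last first.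
    by rewrite lebesgue_measure_itv/= lte_fin; case: ltgtP m1 => // <-; rewrite subrr.
  apply: le_measure; rewrite ?inE//= => s [/andP[_ s1] /eccdf_inv_lt_ge ms].
  by rewrite /= in_itv/= s1 andbT -lee_fin fineK.
- rewrite (_ : (1 - _)%:E = lebesgue_measure `]fine (m c), 1%R]); last first.
    by rewrite lebesgue_measure_itv/= lte_fin; case: ltgtP m1 => // <-; rewrite subrr.
  apply: le_measure; rewrite ?inE//= => s; rewrite /= in_itv/= => /andP[ms s1].
  split; first by rewrite (le_trans m0 (ltW ms)).
  by apply: eccdf_inv_lt; rewrite -(fineK mfin) lte_fin.
Qed.

End roc_area.

(** Tonelli on the set [E] of pairs [(s, x)] with [s] in [[0, 1]] and inverse at [s] below [t x]:
    the section at [s] has [P]-measure [ROC s], and the section at [x] has length [M (t < t x)]. *)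
Lemma AUC_pairwise d (T : measurableType d) (R : realType)
    (P M : probability T R) (t : {mfun T >-> R}) :
  AUC P M t = (\int[P]_x M [set y | (t y < t x)%R])%E.
Proof.
pose E := [set z : R * T | (0 <= z.1 <= 1) /\ (eccdf_inv t M z.1 < (t z.2)%:E)%E].
have mE : measurable E.
  rewrite (_ : E = (fst @^-1` `[0, 1]) `&`
      [set z | (eccdf_inv t M z.1 < (t z.2)%:E)%E]); last first.
    by apply/seteqP; split => x /=; rewrite in_itv/=.
  apply: measurable_lte.
  - by rewrite -[X in measurable X]setTI; exact: measurable_fst.
  - apply: measurable_funTS; apply: measurableT_comp.
      exact: measurable_eccdf_inv.
    exact: measurable_fst.
  - by apply: measurable_funTS; apply/measurable_EFinP; exact: measurableT_comp.
have mEs s : measurable [set x | E (s, x)].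
  by have := measurable_xsection s mE; rewrite xsectionE.
have mEx x : measurable [set s | E (s, x)].
  by have := measurable_ysection x mE; rewrite ysectionE.
transitivity (\int[lebesgue_measure]_s \int[P]_x (\1_E (s, x))%:E)%E.
  rewrite /AUC integral_mkcond; apply: eq_integral => s _.
  rewrite (_ : (\int[P]_x _)%E = P [set x | E (s, x)]); last first.
    by rewrite -(setIT [set x | E (s, x)]) -integral_indic//; exact: eq_integral.
  rewrite patchE; case: ifPn => s01.
    rewrite /ROC eccdfE; congr (P _); apply/seteqP; split => x; rewrite /E//=.
      by move: s01; rewrite inE/= in_itv.
    by case.
  (* For [s] outside [[0, 1]] the section is empty, matching the restricted integral. *)
  rewrite (_ : [set x | _] = set0) ?measure0//.
  apply/seteqP; split => x //=; rewrite /E/= => -[h _].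
  by move: s01; rewrite notin_setE/= in_itv.
have mEF : measurable_fun [set: R * T] (fun z => (\1_E z)%:E : \bar R).
  by apply/measurable_EFinP; exact: measurable_indic.
have E0 z : (0 <= (\1_E z)%:E :> \bar R)%E by rewrite lee_fin.
have := @fubini_tonelli _ _ _ _ R lebesgue_measure P _ mEF E0; move=> ->.
apply: eq_integral => x _.
transitivity (lebesgue_measure [set s | E (s, x)]).
  by rewrite -(setIT [set s | E (s, x)]) -integral_indic//; exact: mEx.
exact: (@lebesgue_eccdf_inv_lt _ _ _ M t (t x)).
Qed.

(** * Scores without atoms *)

(** Tonelli turns the first integral into that of [Q (t >= t x)] over [x] under [P]; without atoms
    this is one minus the cdf under [Q], so the two integrands add up to 1. The case [P = Q] is
    included and gives the value 1/2. *)
Lemma cdf_swap d (T : measurableType d) (R : realType)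
    (P Q : probability T R) (t : {mfun T >-> R}) :
  (forall c, Q [set y | t y = c] = 0%E) ->
  (\int[Q]_y cdf (t : {RV P >-> R}) (t y) +
   \int[P]_x cdf (t : {RV Q >-> R}) (t x) = 1)%E.
Proof.
move=> Q0.
pose E := [set z : T * T | t z.2 <= t z.1].
have mE : measurable E.
  rewrite (_ : E = [set z | ((t z.2)%:E <= (t z.1)%:E)%E]).
    rewrite -[X in measurable X]setTI; apply: measurable_lee => //.
      by apply/measurable_EFinP; exact: measurableT_comp.
    by apply/measurable_EFinP; exact: measurableT_comp.
  by apply/seteqP; split => z /=; rewrite lee_fin.
have mEs y : measurable [set x | E (y, x)].
  by have := measurable_xsection y mE; rewrite xsectionE.
have mEx x : measurable [set y | E (y, x)].
  by have := measurable_ysection x mE; rewrite ysectionE.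
have mle x : measurable [set y | t y <= t x].
  rewrite (_ : mkset _ = t @^-1` `]-oo, t x]); first exact: measurable_funPTI.
  by apply/seteqP; split => y /=; rewrite in_itv.
have cdfE (P' : probability T R) x :
    cdf (t : {RV P' >-> R}) (t x) = P' [set y | t y <= t x].
  by rewrite /cdf /distribution /pushforward; congr (P' _);
    apply/seteqP; split => y /=; rewrite in_itv.
have mcdf (P' : probability T R) :
    measurable_fun [set: T] (fun x => cdf (t : {RV P' >-> R}) (t x)).
  by apply: measurableT_comp => //; exact: cdf_measurable.
have mEF : measurable_fun [set: T * T] (fun z => (\1_E z)%:E : \bar R).
  by apply/measurable_EFinP; exact: measurable_indic.
have E0 z : (0 <= (\1_E z)%:E :> \bar R)%E by rewrite lee_fin.
have -> : (\int[Q]_y cdf (t : {RV P >-> R}) (t y) =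
           \int[P]_x Q [set y | E (y, x)])%E.
  transitivity (\int[Q]_y \int[P]_x (\1_E (y, x))%:E)%E.
    apply: eq_integral => y _; rewrite cdfE.
    by rewrite -(setIT [set x | _]) -integral_indic//; exact: (mEs y).
  have := @fubini_tonelli _ _ _ _ R Q P _ mEF E0; move=> ->.
  apply: eq_integral => x _.
  by rewrite -(setIT [set y | E (y, x)]) -integral_indic//; exact: mEx.
(* The event [t y >= t x] is the null event [t y = t x] together with the complement of
   [t y <= t x]. *)
have QE x : Q [set y | E (y, x)] = (1 - cdf (t : {RV Q >-> R}) (t x))%E.
  rewrite cdfE -probability_setC//.
  rewrite (_ : [set y | E (y, x)] =
      [set y | t y = t x] `|` (~` [set y | t y <= t x])).
    rewrite measureU//.
    - by rewrite [X in (X + _)%E]Q0 add0e.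
    - by rewrite (_ : mkset _ = t @^-1` [set t x])//; exact: measurable_funPTI.
    - exact: measurableC.
    - by apply/seteqP; split => y //= -[-> ]; rewrite lexx.
  apply/seteqP; split => y; rewrite /E/=.
    by rewrite le_eqVlt => /orP[/eqP <-|]; [left|rewrite ltNge => /negP; right].
  by move=> [->//|/negP]; rewrite -ltNge => /ltW.
rewrite -ge0_integralD//=; last first.
  under eq_fun do rewrite QE.
  by apply: emeasurable_funB.
under eq_integral do rewrite QE subeK ?fin_num_measure//.
by rewrite integral_cst// mul1e; exact: (@probability_setT _ _ _ P).
Qed.

(** Lebesgue measure does not see the endpoint [c], so the cdf at [c] equals its left limit, and
    their difference is the mass of [c]. *)
Lemma cdf_density_atomless d (T : measurableType d) (R : realType)
    (P : probability T R) (t : {mfun T >-> R}) (f : R -> R) (c : R) :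
  is_density_of (fun r => fine (cdf (t : {RV P >-> R}) r)) f ->
  P [set x | t x = c] = 0%E.
Proof.
move=> [mf f0 Ff].
pose F n := `]-oo, c - n.+1%:R^-1]%classic.
have mF n : measurable (F n) by exact: measurable_itv.
have FU : \bigcup_n F n = `]-oo, c[%classic.
  apply/seteqP; split => x /=.
    by move=> [n _]; rewrite /F/= !in_itv/= => /le_lt_trans; apply;
      rewrite ltrBlDr ltrDl invr_gt0.
  rewrite in_itv/= => xc; have [k] := ltr_add_invr xc.
  by move=> h; exists k => //; rewrite /F/= in_itv/= lerBrDr ltW.
have ndF : nondecreasing_seq F.
  move=> i j ij; apply/subsetPset => x; rewrite /F/= !in_itv/= => /le_trans; apply.
  by rewrite lerD2l lerN2 lef_pV2 ?posrE// ler_nat.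
have PF : (distribution P t (F n) @[n --> \oo] --> distribution P t `]-oo, c[)%E.
  rewrite -FU; apply: nondecreasing_cvg_mu => //; exact: bigcup_measurable.
have mfE A : measurable A -> measurable_fun A (EFin \o f).
  by move=> mA; apply: measurable_funTS; exact/measurable_EFinP.
have IF : (\int[lebesgue_measure]_(u in F n) (f u)%:E @[n --> \oo] -->
           \int[lebesgue_measure]_(u in `]-oo, c[) (f u)%:E)%E.
  rewrite -FU; apply: ge0_nondecreasing_set_cvg_integral => //.
  - by move=> i; exact: mfE.
  - by move=> i x _; rewrite lee_fin.
have cE r : cdf (t : {RV P >-> R}) r =
    (\int[lebesgue_measure]_(u in `]-oo, r]) (f u)%:E)%E.
  by rewrite -Ff fineK// fin_num_measure.
(* Both sides are limits along the half-lines [F n], on which the law and the integral of [f]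
   agree. *)
have Plt : distribution P t `]-oo, c[ = cdf (t : {RV P >-> R}) c.
  rewrite cE -(@integral_itv_bndo_bndc _ -oo%O c)//; last exact: mfE.
  apply: (cvg_unique _ PF) => //.
  apply: cvg_trans IF; apply: near_eq_cvg; near=> n.
  by rewrite -cE.
have cfin : cdf (t : {RV P >-> R}) c \is a fin_num by exact: fin_num_measure.
have : (cdf (t : {RV P >-> R}) c = distribution P t `]-oo, c[ +
    distribution P t [set c])%E.
  rewrite /cdf -(@setUitv1 _ _ -oo%O c true)// measureU//.
  by apply/seteqP; split => x //=; rewrite in_itv/= => -[/[swap] ->]; rewrite ltxx.
rewrite Plt => /(congr1 (fun z => z - cdf (t : {RV P >-> R}) c)%E).
by rewrite subee// addeAC subee// add0e => /esym.
Unshelve. all: by end_near. Qed.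

(** * Integration against a law given by a density *)

Section density_integral.
Context (R : realType) (n : nat) (X : set (n.-tuple R)) (p : density X).
Local Open Scope ereal_scope.

Lemma measurable_EFin_density D : measurable_fun D (EFin \o p).
Proof. by apply: measurable_funTS; exact/measurable_EFinP. Qed.

Lemma density_prob_dominated : density_prob p `<< lebesgue_tuple R n.
Proof.
apply/null_content_dominatesP => A mA A0.
by rewrite /density_prob null_set_integral//; exact: measurable_EFin_density.
Qed.

(** The change of variables involves the Radon-Nikodym derivative, which equals [p] almost
    everywhere because both have the same integral over every measurable set. *)
Lemma integral_density_prob (f : n.-tuple R -> \bar R) :
  measurable_fun [set: n.-tuple R] f -> (forall x, 0 <= f x) ->
  \int[density_prob p]_x f x = \int[lebesgue_tuple R n]_x (f x * (p x)%:E).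
Proof.
move=> mf f0.
have pmu := density_prob_dominated.
rewrite -(Radon_Nikodym_SigmaFinite.change_of_variables pmu)//.
have rnI := Radon_Nikodym_SigmaFinite.f_integrable pmu.
apply: ae_eq_integral => //.
- by apply: emeasurable_funM => //; exact: measurable_int rnI.
- by apply: emeasurable_funM => //; exact: measurable_EFin_density.
- apply: ae_eqe_mul2l; apply: integral_ae_eq => //.
  + exact: measurable_EFin_density.
  + by move=> E _ mE; rewrite -Radon_Nikodym_SigmaFinite.f_integral.
Qed.

Lemma eq_integral_density_prob (f g : n.-tuple R -> \bar R) :
  measurable_fun [set: n.-tuple R] f -> measurable_fun [set: n.-tuple R] g ->
  (forall x, X x -> f x = g x) ->
  \int[density_prob p]_x f x = \int[density_prob p]_x g x.
Proof.
move=> mf mg fg; apply: ae_eq_integral => //.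
(* The zero set of [p] is measurable, null for the law, and contains the complement of [X]. *)
exists (p @^-1` [set 0%R]); split.
- exact: measurable_funPTI.
- by apply: integral0_eq => x /= ->.
- move=> x /= h; apply: contrapT => px; apply: h => _; apply: fg.
  by apply: contrapT => Xx; apply: px; exact: density_eq0.
Qed.

End density_integral.

(** * Trigonometry of the angle [tstar] *)

Lemma cospi4_sinpi4 (R : realType) : cos (pi / 4) = sin (pi / 4) :> R.
Proof.
have pi0 := pi_gt0 R.
have c0 : cos (pi / 4) != 0 :> R by rewrite gt_eqF// cos_gt0_pihalf//; lra.
by have := tan_piquarter R; rewrite /tan => /(canRL (divfK c0)); rewrite mul1r.
Qed.

Lemma sinpi4 (R : realType) : sin (pi / 4) = Num.sqrt 2 / 2 :> R.
Proof.
have pi0 := pi_gt0 R.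
have s0 : 0 < sin (pi / 4) :> R by rewrite sin_gt0_pi//; lra.
have := cos2Dsin2 (pi / 4 : R); rewrite cospi4_sinpi4 => h.
have r0 : 0 <= Num.sqrt 2 / 2 :> R by rewrite divr_ge0 ?sqrtr_ge0.
apply/eqP; rewrite -(@eqrXn2 _ 2 _ _ isT (ltW s0) r0) expr_div_n sqr_sqrtr//.
by apply/eqP; lra.
Qed.

Section score_angle.
Context (R : realType) (n : nat) (X : set (n.-tuple R)) (pp pm : density X).
Hypothesis pm_gt0 : forall x, X x -> 0 < pm x.
Local Notation tau := (tstar pp pm).

Lemma cos_tstar_gt0 x : 0 < cos (tau x).
Proof. by apply: cos_gt0_pihalf; rewrite atan_gtNpi2 atan_ltpi2. Qed.

Lemma tan_tstar x : sin (tau x) = pp x / pm x * cos (tau x).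
Proof.
have := cos_tstar_gt0 x => /lt0r_neq0 c0.
by rewrite -[pp x / pm x]atanK -/(tau x) /tan mulrVK ?unitfE.
Qed.

Lemma sin_tstar_ge0 x : 0 <= sin (tau x).
Proof.
by rewrite tan_tstar mulr_ge0// ?divr_ge0 ?density_ge0// ltW// cos_tstar_gt0.
Qed.

(** This holds off [X] too: there the quotient is 0 / 0, which is 0 by convention. *)
Lemma tstar_bounds x : 0 <= tau x <= pi / 2.
Proof.
rewrite (ltW (atan_ltpi2 _)) andbT -(@atan0 R); apply: le_atan.
by rewrite divr_ge0 ?density_ge0.
Qed.

(* (pm, pp) points in the direction tau. *)
Lemma density_polar x : exists2 k, 0 <= k &
  pp x = k * sin (tau x) /\ pm x = k * cos (tau x).
Proof.
have c0 := cos_tstar_gt0 x; have /lt0r_neq0 c1 := c0.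
have [Xx|Xx] := pselect (X x); last first.
  by exists 0 => //; rewrite !mul0r !density_eq0.
have /lt0r_neq0 m1 := pm_gt0 _ Xx.
exists (pm x / cos (tau x)); first by rewrite divr_ge0// ?density_ge0// ltW.
by rewrite tan_tstar; split; field; rewrite ?m1 ?c1.
Qed.

(** In polar form the two sides are [k * cos (tau x - a)] and [k]. *)
Lemma density_angle_le x a :
  pp x * sin a + pm x * cos a <= pp x * sin (tau x) + pm x * cos (tau x).
Proof.
have [k k0 [-> ->]] := density_polar x.
have -> : k * sin (tau x) * sin a + k * cos (tau x) * cos a = k * cos (tau x - a).
  by rewrite cosB; ring.
have -> : k * sin (tau x) * sin (tau x) + k * cos (tau x) * cos (tau x) = k.
  by rewrite -[RHS]mulr1 -(cos2Dsin2 (tau x)); ring.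
by rewrite ler_piMr// cos_le1.
Qed.

(** The second factor is the length [k], and the first is [sqrt 2 / 2] times
    [sin (tau x) + cos (tau x)]. This is the purpose of the sine in [w]: the length is replaced by
    the sum of the densities. *)
Lemma sinD_pi4_density x :
  sin (tau x + pi / 4) * (pp x * sin (tau x) + pm x * cos (tau x)) =
  Num.sqrt 2 / 2 * (pp x + pm x).
Proof.
have [k k0 [-> ->]] := density_polar x.
rewrite sinD cospi4_sinpi4 sinpi4.
transitivity (Num.sqrt 2 / 2 * (k * sin (tau x) + k * cos (tau x)) *
  (cos (tau x) ^+ 2 + sin (tau x) ^+ 2)); first by ring.
by rewrite cos2Dsin2 mulr1.
Qed.

End score_angle.

(** * The weight [w], and the objective as one Lebesgue integral *)

Section objective_value.
Context (R : realType) (n : nat) (X : set (n.-tuple R)) (pp pm : density X).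
Hypothesis pm_gt0 : forall x, X x -> 0 < pm x.
Local Notation tau := (tstar pp pm).
Local Notation Fp := (Fstar pp pm pp).
Local Notation Fm := (Fstar pp pm pm).
Local Notation mu := (lebesgue_tuple R n).

Lemma FstarE (p : density X) (r : R) :
  (Fstar pp pm p r)%:E = cdf (tau : {RV density_prob p >-> R}) r.
Proof. by rewrite fineK// fin_num_measure. Qed.

Lemma Fstar_ge0 (p : density X) r : 0 <= Fstar pp pm p r.
Proof. by rewrite -lee_fin FstarE cdf_ge0. Qed.

Lemma Fstar_le1 (p : density X) r : Fstar pp pm p r <= 1.
Proof. by rewrite -lee_fin FstarE cdf_le1. Qed.

Lemma measurable_Fstar (p : density X) : measurable_fun [set: R] (Fstar pp pm p).
Proof.
apply/measurable_EFinP.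
rewrite (_ : EFin \o _ = cdf (tau : {RV density_prob p >-> R})).
  exact: cdf_measurable.
by apply/funext => r; exact: FstarE.
Qed.

(** Arctan increases and equals [pi / 4] at 1, so the position of the score relative to [pi / 4]
    compares the two densities. *)
Lemma density_le_of_tstar_le x : tau x <= pi / 4 -> pp x <= pm x.
Proof.
have [Xx|Xx] := pselect (X x); last by rewrite !density_eq0.
rewrite leNgt -atan1; apply: contraNle => h.
by apply: lt_atan; rewrite ltr_pdivlMr ?mul1r// pm_gt0.
Qed.

Lemma density_ge_of_tstar_gt x : pi / 4 < tau x -> pm x <= pp x.
Proof.
have [Xx|Xx] := pselect (X x); last by rewrite !density_eq0.
rewrite ltNge -atan1; apply: contraNle => h.
by apply: le_atan; rewrite ler_pdivrMr ?pm_gt0// mul1r ltW.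
Qed.

(* Compare the densities below the level where the likelihood ratio is 1, and
   the complementary events above it. *)
Lemma Fstar_le r : Fp r <= Fm r.
Proof.
have mA (A : set R) : measurable A -> measurable (tau @^-1` A).
  by move=> mA; exact: measurable_funPTI.
have intle (A : set R) (p q : density X) : measurable A ->
    (forall x, A (tau x) -> p x <= q x) ->
    (density_prob p (tau @^-1` A) <= density_prob q (tau @^-1` A))%E.
  move=> mA' pq; have mtA := mA _ mA'; apply: ge0_le_integral => //.
  - by move=> x _; rewrite lee_fin density_ge0.
  - exact: measurable_EFin_density.
  - exact: measurable_EFin_density.
rewrite -lee_fin !FstarE; have [r4|r4] := leP r (pi / 4).
  apply: (intle `]-oo, r]%classic pp pm) => // x /=; rewrite in_itv/= => xr.
  by apply: density_le_of_tstar_le; exact: le_trans r4.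
rewrite !cdf_1_ccdf; apply: leeB => //.
apply: (intle `]r, +oo[%classic pm pp) => // x /=; rewrite in_itv/= andbT => xr.
by apply: density_ge_of_tstar_gt; exact: lt_trans xr.
Qed.

(** Nonnegativity allows the objective to be treated by the theorems on nonnegative integrals. *)
Lemma w_tstar_ge0 x : 0 <= w pp pm (tau x).
Proof.
rewrite mulr_ge0// sinD cospi4_sinpi4 sinpi4 -mulrDl mulr_ge0// ?divr_ge0 ?sqrtr_ge0//.
by rewrite addr_ge0// ?sin_tstar_ge0// ltW// cos_tstar_gt0.
Qed.

Lemma w_tstar_density x :
  w pp pm (tau x) * (pp x * sin (tau x) + pm x * cos (tau x)) =
  Num.sqrt 2 / 2 * (Fm (tau x) - Fp (tau x)) * (pp x + pm x).
Proof.
rewrite /w mulrAC sinD_pi4_density// distrC ger0_norm ?subr_ge0 ?Fstar_le//.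
by rewrite mulrAC.
Qed.

Lemma measurable_w : measurable_fun [set: R] (w pp pm).
Proof.
apply: measurable_funM.
  apply: continuous_measurable_fun => x.
  apply: (@continuous_comp _ _ _ (fun y => y + pi / 4) sin).
    by apply: cvgD; [exact: cvg_id|exact: cvg_cst].
  exact: continuous_sin.
apply: measurableT_comp => //; apply: measurable_funB; exact: measurable_Fstar.
Qed.

(** Merging expectations under two laws into one integral makes a pointwise comparison in [x]
    possible. *)
Lemma integral_density_pair (g h : n.-tuple R -> R) :
  measurable_fun [set: n.-tuple R] g -> measurable_fun [set: n.-tuple R] h ->
  (forall x, 0 <= g x) -> (forall x, 0 <= h x) ->
  (\int[density_prob pp]_x (g x)%:E + \int[density_prob pm]_x (h x)%:E =
   \int[mu]_x (g x * pp x + h x * pm x)%:E)%E.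
Proof.
move=> mg mh g0 h0.
have mp (p : density X) (f : n.-tuple R -> R) :
    measurable_fun [set: n.-tuple R] f ->
    measurable_fun [set: n.-tuple R] (fun x => (f x)%:E * (p x)%:E)%E.
  move=> mf; apply: emeasurable_funM; first exact/measurable_EFinP.
  exact: measurable_EFin_density.
rewrite !integral_density_prob//; first last.
- exact/measurable_EFinP.
- exact/measurable_EFinP.
rewrite -ge0_integralD//.
- by move=> x _; rewrite mule_ge0// lee_fin// density_ge0.
- exact: mp.
- by move=> x _; rewrite mule_ge0// lee_fin// density_ge0.
- exact: mp.
Qed.

Lemma measurable_objective_sin (v : n.-tuple R -> R) :
  measurable_fun [set: n.-tuple R] v ->
  measurable_fun [set: n.-tuple R] (fun x => w pp pm (tau x) * sin (v x)).
Proof.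
move=> mv; apply: measurable_funM.
  by apply: measurableT_comp; [exact: measurable_w|exact: measurable_funPT].
by apply: measurableT_comp => //; apply: continuous_measurable_fun;
  exact: continuous_sin.
Qed.

Lemma measurable_objective_cos (v : n.-tuple R -> R) :
  measurable_fun [set: n.-tuple R] v ->
  measurable_fun [set: n.-tuple R] (fun x => w pp pm (tau x) * cos (v x)).
Proof.
move=> mv; apply: measurable_funM.
  by apply: measurableT_comp; [exact: measurable_w|exact: measurable_funPT].
by apply: measurableT_comp => //; apply: continuous_measurable_fun;
  exact: continuous_cos.
Qed.

(** The bounds on [v] are imposed at every point, so that sine and cosine are nonnegative
    everywhere; an admissible [v] is clamped before this is applied. *)
Lemma objectiveE (v : n.-tuple R -> R) :
  measurable_fun [set: n.-tuple R] v -> (forall x, 0 <= v x <= pi / 2) ->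
  objective pp pm v =
  (\int[mu]_x (w pp pm (tau x) * (pp x * sin (v x) + pm x * cos (v x)))%:E)%E.
Proof.
move=> mv v01.
rewrite /objective unlock integral_density_pair.
- by apply: eq_integral => x _; congr EFin; ring.
- exact: measurable_objective_sin.
- exact: measurable_objective_cos.
- move=> x; have /andP[v0 v1] := v01 x.
  rewrite mulr_ge0 ?w_tstar_ge0// sin_ge0_pi// v0 (le_trans v1)//.
  by have := pi_gt0 R; lra.
- move=> x; have /andP[v0 v1] := v01 x.
  rewrite mulr_ge0 ?w_tstar_ge0// cos_ge0_pihalf// v1 andbT.
  by have := pi_gt0 R; lra.
Qed.

End objective_value.

(** Off [X] the density is 0, so the integrands extended by 0 agree pointwise. *)
Lemma eq_density_prob (R : realType) (n : nat) (X : set (n.-tuple R))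
    (p : density X) (A B : set (n.-tuple R)) :
  (forall x, X x -> A x <-> B x) -> density_prob p A = density_prob p B.
Proof.
move=> AB; rewrite /density_prob integral_mkcond [RHS]integral_mkcond.
apply: eq_integral => x _; rewrite !patchE.
have [Xx|Xx] := pselect (X x); last by rewrite !density_eq0// !if_same.
by rewrite (_ : (x \in A) = (x \in B))//; apply/idP/idP; rewrite !inE AB.
Qed.

(** * The maximizing angle, the maximal value and the AUC of optimal scores *)

Section optimal_value.
Context (R : realType) (n : nat) (X : set (n.-tuple R)) (pp pm : density X).
Hypothesis pm_gt0 : forall x, X x -> 0 < pm x.
Local Notation tau := (tstar pp pm).
Local Notation P := (density_prob pp).
Local Notation M := (density_prob pm).

Lemma admissible_tstar : admissible X tau.
Proof. by split=> [|x _]; [exact: measurable_funPT|exact: tstar_bounds]. Qed.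

Lemma eq_objective (v v' : n.-tuple R -> R) :
  measurable_fun [set: n.-tuple R] v -> measurable_fun [set: n.-tuple R] v' ->
  (forall x, X x -> v x = v' x) -> objective pp pm v = objective pp pm v'.
Proof.
move=> mv mv' vv'; rewrite /objective unlock; congr (_ + _)%E;
  apply: eq_integral_density_prob => [| |x Xx]; rewrite ?vv'//;
  apply/measurable_EFinP;
  by [exact: measurable_objective_sin|exact: measurable_objective_cos].
Qed.

Lemma objective_le_tstar v : admissible X v ->
  (objective pp pm v <= objective pp pm tau)%E.
Proof.
move=> [mv v01].
have pi0 := pi_gt0 R.
(* Clamping to [[0, pi / 2]] leaves [v] unchanged on [X], hence also its objective. *)
pose v' x := Num.max 0 (Num.min (v x) (pi / 2)).
have mv' : measurable_fun [set: n.-tuple R] v'.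
  by apply: measurable_maxr => //; exact: measurable_minr.
have v'01 x : 0 <= v' x <= pi / 2.
  by rewrite /v' le_max lexx ge_max ge_min lexx orbT andbT divr_ge0// ltW.
rewrite (@eq_objective v v')//; last first.
  move=> x /v01 /andP[v0 v1]; rewrite /v' (min_idPl v1).
  by rewrite (max_idPr v0).
have mtau : measurable_fun [set: n.-tuple R] tau by exact: measurable_funPT.
rewrite !objectiveE//; last by move=> x; exact: tstar_bounds.
have mI u : measurable_fun [set: n.-tuple R] u -> measurable_fun
    [set: n.-tuple R]
    (fun x => (w pp pm (tau x) * (pp x * sin (u x) + pm x * cos (u x)))%:E).
  move=> mu; apply/measurable_EFinP.
  rewrite (_ : (fun x => _) = (fun x => (w pp pm (tau x) * sin (u x)) * pp x) \+
      (fun x => (w pp pm (tau x) * cos (u x)) * pm x)); last first.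
    by apply/funext => x /=; ring.
  apply: measurable_funD; apply: measurable_funM; try exact: density_measurable.
    exact: measurable_objective_sin.
  exact: measurable_objective_cos.
apply: ge0_le_integral => //.
- move=> x _; have /andP[v0 v1] := v'01 x.
  rewrite lee_fin mulr_ge0 ?w_tstar_ge0// addr_ge0// mulr_ge0 ?density_ge0//.
    by rewrite sin_ge0_pi// v0 (le_trans v1)//; lra.
  by rewrite cos_ge0_pihalf// v1 andbT; lra.
- exact: mI.
- exact: mI.
- move=> x _; rewrite lee_fin ler_wpM2l ?w_tstar_ge0//.
  exact: density_angle_le.
Qed.

Lemma objective_tstar_max :
  objective pp pm tau = ereal_sup [set objective pp pm v | v in admissible X].
Proof.
apply/eqP; rewrite eq_le; apply/andP; split.
  by apply: ereal_sup_ubound; exists tau => //; exact: admissible_tstar.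
by apply: ge_ereal_sup => _ [v /objective_le_tstar ? <-].
Qed.

(** At the optimal angle the integrand is [D x * (pp x + pm x)], which splits back into one integral
    under each law. *)
Lemma objective_tstarE :
  let D x := (Num.sqrt 2 / 2 * (Fstar pp pm pm (tau x) - Fstar pp pm pp (tau x))) in
  objective pp pm tau = (\int[P]_x (D x)%:E + \int[M]_x (D x)%:E)%E.
Proof.
move=> D.
have mtau : measurable_fun [set: n.-tuple R] tau by exact: measurable_funPT.
have mD : measurable_fun [set: n.-tuple R] D.
  apply: measurable_funM => //; apply: measurable_funB;
    by apply: measurableT_comp => //; exact: measurable_Fstar.
have D0 x : 0 <= D x.
  by rewrite mulr_ge0 ?divr_ge0 ?sqrtr_ge0// subr_ge0 Fstar_le.
rewrite objectiveE//; last by move=> x; exact: tstar_bounds.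
rewrite integral_density_pair//; apply: eq_integral => x _; congr EFin.
by rewrite w_tstar_density// mulrDr.
Qed.

(** A cdf is bounded by 1. Integrability is what permits splitting the integral of a difference of
    cdfs. *)
Lemma integrable_Fstar (p q : density X) :
  (density_prob q).-integrable [set: n.-tuple R]
    (fun x => (Fstar pp pm p (tau x))%:E).
Proof.
apply: (@le_integrable _ _ _ _ _ measurableT _ (EFin \o cst 1)) => //.
- apply/measurable_EFinP; apply: measurableT_comp; first exact: measurable_Fstar.
  exact: measurable_funPT.
- move=> x _ /=; rewrite lee_fin normr1 ger0_norm ?Fstar_ge0//.
  exact: Fstar_le1.
- exact: finite_measure_integrable_cst.
Qed.

Lemma AUC_optimal (t : {mfun n.-tuple R >-> R}) :
  (forall c, M [set x | tau x = c] = 0%E) ->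
  optimal_score pp pm t ->
  AUC P M t = (\int[P]_x (Fstar pp pm pm (tau x))%:E)%E.
Proof.
move=> M0 [gamma ginc tE]; rewrite AUC_pairwise.
have r0 x : pp x / pm x \in `[0, +oo[.
  by rewrite in_itv/= andbT divr_ge0 ?density_ge0.
have mlt (s : {mfun n.-tuple R >-> R}) c : measurable [set y | s y < c].
  rewrite (_ : mkset _ = s @^-1` `]-oo, c[); first exact: measurable_funPTI.
  by apply/seteqP; split => y /=; rewrite in_itv.
(* Both [gamma] and arctan are strictly increasing, so [t] and [tau] order [X] in the same way. *)
have ltE x y : X x -> X y -> (t x < t y) = (tau x < tau y).
  move=> Xx Xy; rewrite !tE// /tstar.
  rewrite (leW_mono_in (le_mono_in ginc))//.
  by rewrite (leW_mono (le_mono (@lt_atan R))).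
have mtau (A : set R) : measurable A -> measurable (tau @^-1` A).
  by move=> mA; exact: measurable_funPTI.
apply: eq_integral_density_prob => [||x Xx].
(* Measurability: this is a nondecreasing function of the level, composed with [t]. *)
- have -> : (fun x => M [set y | t y < t x]) =
    EFin \o ((fun c => fine (M [set y | t y < c])) \o t).
    by apply/funext => x /=; rewrite fineK// fin_num_measure.
  apply/measurable_EFinP; apply: measurableT_comp => //.
  apply: nondecreasing_measurable => // a b ab.
  rewrite fine_le ?fin_num_measure// le_measure ?inE//.
  by move=> y /= /lt_le_trans; exact.
- apply/measurable_EFinP; apply: measurableT_comp; first exact: measurable_Fstar.
  exact: measurable_funPT.
transitivity (distribution M tau `]-oo, tau x[).
  by apply: (@eq_density_prob _ _ _ pm) => y Xy; rewrite /= in_itv/= ltE.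
rewrite FstarE /cdf -(@setUitv1 _ _ -oo%O (tau x) true)// measureU//.
  by rewrite [X in (_ + X)%E]M0 adde0.
by apply/seteqP; split => y //=; rewrite in_itv/= => -[/[swap] ->]; rewrite ltxx.
Qed.

End optimal_value.

(** * Evaluation of the four integrals of cdfs *)

Theorem proposition5 (R : realType) (n : nat) (X : set (n.-tuple R))
    (pp pm : density X) (fp fm : R -> R) :
  measurable X ->
  (forall x, X x -> 0 < pm x) ->
  (forall a b, score_interval pp pm a -> score_interval pp pm b -> a < b ->
     Fstar pp pm pp a < Fstar pp pm pp b) ->
  (forall a b, score_interval pp pm a -> score_interval pp pm b -> a < b ->
     Fstar pp pm pm a < Fstar pp pm pm b) ->
  is_density_of (Fstar pp pm pp) fp ->
  is_density_of (Fstar pp pm pm) fm ->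
  (forall tau, score_interval pp pm tau -> 0 < fm tau) ->
  let A := ereal_sup [set objective pp pm v | v in admissible X] in
  [/\ forall t : {mfun n.-tuple R >-> R}, optimal_score pp pm t ->
        (AUC (density_prob pp) (density_prob pm) t =
         (Num.sqrt 2 / 2)%:E * A + (1 / 2)%:E)%E,
      admissible X (tstar pp pm) &
      objective pp pm (tstar pp pm) = A].
Proof.
move=> _ pm_gt0 _ _ Dp Dm _ A.
have objA : objective pp pm (tstar pp pm) = A by exact: objective_tstar_max.
split=> //; last exact: admissible_tstar.
move=> t topt.
pose tau : {mfun n.-tuple R >-> R} := tstar pp pm.
have P0 c : density_prob pp [set x | tau x = c] = 0%E.
  exact: (@cdf_density_atomless _ _ _ _ tau fp).
have M0 c : density_prob pm [set x | tau x = c] = 0%E.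
  exact: (@cdf_density_atomless _ _ _ _ tau fm).
rewrite (AUC_optimal _ _ _ _ _ _ M0 topt) -objA objective_tstarE//.
pose I (q p : density X) : \bar R :=
  (\int[density_prob q]_x (Fstar pp pm p (tau x))%:E)%E.
(* Finiteness moves the identity to the reals, where it becomes linear arithmetic. *)
have Ifin q p : I q p = (fine (I q p))%:E.
  by rewrite fineK//; apply: integrable_fin_num => //; exact: integrable_Fstar.
have Iswap p q : (forall c, density_prob q [set x | tau x = c] = 0%E) ->
    fine (I q p) + fine (I p q) = 1.
  move=> q0; apply: EFin_inj; rewrite EFinD -!Ifin /I.
  under eq_integral do rewrite FstarE.
  under [X in (_ + X)%E]eq_integral do rewrite FstarE.
  exact: (@cdf_swap _ _ _ (density_prob p) (density_prob q) tau).
have ID q : (\int[density_prob q]_x (Num.sqrt 2 / 2 *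
    (Fstar pp pm pm (tau x) - Fstar pp pm pp (tau x)))%:E =
    (Num.sqrt 2 / 2 * (fine (I q pm) - fine (I q pp)))%:E)%E.
  under eq_integral do rewrite EFinM EFinB.
  rewrite integralZl//; last by apply: integrableB => //; exact: integrable_Fstar.
  rewrite integralB//; [|exact: integrable_Fstar..].
  by rewrite [RHS]EFinM EFinB -!Ifin.
rewrite !ID -/(I pp pm) [LHS]Ifin -!EFinD; congr EFin.
have s2 : (Num.sqrt 2 / 2) * (Num.sqrt 2 / 2) = 1 / 2 :> R.
  by rewrite -expr2 expr_div_n sqr_sqrtr//; field.
have := Iswap pp pp P0; have := Iswap pm pm M0; have := Iswap pp pm M0.
move: (fine (I pm pp)) (fine (I pp pm)) (fine (I pm pm)) (fine (I pp pp)).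
(* Here [b] is the AUC, and the swap relations say [a + b = 1] and [c = d = 1/2]. Since
   [s * s = 1/2], the right side is [((b - d) + (c - a)) / 2 + 1/2 = b]. *)
move=> a b c d; set s := Num.sqrt 2 / 2 in s2 *.
rewrite -mulrDr mulrA s2; lra.
Qed.
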